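(* Let $a,b,c,d\in\mathbb R$, let $\tau>0$, let $s_0\in\mathbb R$, and let $\Delta:\mathbb C\to\mathbb C$ be the quasipolynomial $$\Delta(s)=s-a-e^{-s\tau}\left(sd-ad+bc\right).$$ (a) The number $s_0$ is a root of multiplicity $3$ of $\Delta$ if and only if the coefficients $a,b,c,d$, the root $s_0$, and the delay $\tau$ satisfy the relations $$a=s_0+\frac{2}{\tau},\qquad d=-e^{s_0\tau},\qquad bc=-\frac{4}{\tau}e^{s_0\tau}.\qquad(\ast)$$ (b) If $(\ast)$ is satisfied, then $s_0$ is a dominant root of $\Delta$. Moreover, for every other complex root $s$ of $\Delta$, one has $\operatorname{Re}s=s_0$. (c) Let $\Xi=\{\xi\in\mathbb R\mid\tan\xi=\xi\}$. If $(\ast)$ is satisfied, then the set of (complex) roots of $\Delta$ is $\left\{s_0+i\frac{2}{\tau}\xi\;\middle|\;\xi\in\Xi\right\}$.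
   Context: The function $\Delta$ is the characteristic quasipolynomial of the delay differential-algebraic system $x'(t)=ax(t)+by(t-\tau)$, $y(t)=cx(t)+dy(t-\tau)$ with $x(t),y(t)\in\mathbb R$ and delay $\tau>0$. Given $Q:\mathbb C\to\mathbb C$ and $s_0\in\mathbb C$ with $Q(s_0)=0$, $s_0$ is called a dominant root of $Q$ if, for every $s\in\mathbb C\setminus\{s_0\}$ such that $Q(s)=0$, one has $\operatorname{Re}s\le\operatorname{Re}s_0$. *)

(* Defs.v *)
(* Stdlib real numbers, with Coquelicot for complex numbers and derivatives. *)
From Stdlib Require Import Reals.
From Coquelicot Require Import Coquelicot.

Open Scope R_scope.
Open Scope C_scope.

(* exp (x + iy) = e^x (cos y + i sin y); Coquelicot has no complex exponential. *)
Definition Cexp (z : C) : C :=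
  (exp (Re z) * cos (Im z), exp (Re z) * sin (Im z))%R.

Fixpoint C_derive_n (f : C -> C) (n : nat) (z : C) : C :=
  match n with
  | O => f z
  | S k => C_derive (C_derive_n f k) z
  end.

(* The complex derivatives of orders 0, ..., m - 1 vanish at z0 and the one of
   order m does not.  [C_derive] is total, with an unspecified value where f is
   not complex differentiable, so the first conjunct requires that the
   derivatives genuinely exist near z0. *)
Definition root_of_multiplicity (f : C -> C) (z0 : C) (m : nat) : Prop :=
  (forall k : nat, (k < m)%nat ->
     locally z0 (fun z : C => ex_derive (C_derive_n f k) z)) /\
  (forall k : nat, (k < m)%nat -> C_derive_n f k z0 = 0) /\
  C_derive_n f m z0 <> 0.

Definition dominant_root (Q : C -> C) (s0 : C) : Prop :=
  Q s0 = 0 /\ forall s : C, s <> s0 -> Q s = 0 -> (Re s <= Re s0)%R.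

Definition quasipolynomial (a b c d tau : R) (s : C) : C :=
  s - a - Cexp (- s * tau) * (s * d - a * d + b * c).

Definition triple_root_relations (a b c d tau s0 : R) : Prop :=
  (a = s0 + 2 / tau /\
   d = - exp (s0 * tau) /\
   b * c = - (4 / tau) * exp (s0 * tau))%R.

(* Stdlib's [tan] is total, defined as sin / cos, so the points where the
   tangent is not defined are excluded explicitly. *)
Definition Xi (xi : R) : Prop := cos xi <> 0%R /\ tan xi = xi.

(* Main.v *)
(* With [u = (s - s0) tau] the relations turn the equation for the roots into
   [exp u * (2 - u) = 2 + u], that is [tanh (u / 2) = u / 2].  For a root
   [u = p + i q] this gives [q sinh p = p sin q], which is impossible for
   [p <> 0] since [|sinh p| > |p|] and [|sin q| <= |q|] (the case [q = 0] being
   that of a real root of [tanh x = x]).  Hence [u] is purely imaginary and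
   [q / 2] is a fixed point of the tangent. *)
Require Import Defs.
From Stdlib Require Import Reals Psatz FunctionalExtensionality.
From Coquelicot Require Import Coquelicot.

Open Scope R_scope.
Open Scope C_scope.

(** * Elementary bounds on the real sine, cosine and exponential *)

Lemma Rabs_sin_le (x : R) : (Rabs (sin x) <= Rabs x)%R.
Proof.
assert (H : forall y, (0 < y -> Rabs (sin y) <= y)%R).
{ intros y Hy. apply Rabs_le. split.
  (* From 1 on, the bound of the sine by 1 suffices; below 1 the sine is nonnegative because 1 < PI
     / 2. *)
  - destruct (Rle_dec 1 y) as [H1|H1].
    + pose proof (SIN_bound y); lra.
    + assert (0 <= sin y)%R by (apply sin_ge_0; pose proof PI2_1; lra). lra.
  - left. now apply sin_lt_x. }
destruct (Rtotal_order x 0) as [Hx|[->|Hx]].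
- rewrite <- (Rabs_Ropp (sin x)), <- sin_neg, (Rabs_left x) by lra.
  apply H; lra.
- rewrite sin_0; lra.
- rewrite (Rabs_right x) by lra. now apply H.
Qed.

(** The inequality 1 + x <= exp x makes the remainder nonnegative; at - x it gives exp x * (1 - x)
    <= 1, where 1 - x is at least 1/2. *)
Lemma exp_remainder (x : R) : (x <= / 2 -> Rabs (exp x - 1 - x) <= 2 * x ^ 2)%R.
Proof.
intros Hx.
pose proof (exp_ineq1_le x) as H1. pose proof (exp_ineq1_le (- x)) as H2.
pose proof (exp_pos x) as H3.
assert (H4 : (exp x * exp (- x) = 1)%R) by (rewrite <- exp_plus, Rplus_opp_r; apply exp_0).
rewrite Rabs_right by lra. nra.
Qed.

Lemma cos_remainder (x : R) : (Rabs (cos x - 1) <= x ^ 2)%R.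
Proof.
replace (cos x - 1)%R with (- (2 * (sin (x / 2)) ^ 2))%R.
- rewrite Rabs_Ropp, Rabs_right by (pose proof (pow2_ge_0 (sin (x / 2))); lra).
  pose proof (Rabs_sin_le (x / 2)) as H. apply Rsqr_le_abs_1 in H.
  unfold Rsqr in H. nra.
- replace (cos x) with (cos (2 * (x / 2))) by (f_equal; field).
  rewrite cos_2a_sin. ring.
Qed.

(** The mean value theorem turns the difference into (cos c - 1) * x with |c| <= |x|, which is cubic
    in x. *)
Lemma sin_remainder (x : R) : (Rabs x <= 1 -> Rabs (sin x - x) <= x ^ 2)%R.
Proof.
intros Hx.
destruct (MVT_gen (fun y => sin y - y)%R 0 x (fun y => cos y - 1)%R) as (c & Hc & E).
- intros y _. auto_derive; [easy | ring].
- intros y _. apply continuity_pt_minus; [apply continuity_sin | apply derivable_continuous_pt, derivable_pt_id].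
- rewrite sin_0 in E. replace (sin x - x)%R with ((cos c - 1) * x)%R by lra.
  assert (Hcx : (Rabs c <= Rabs x)%R).
  { revert Hc. unfold Rmin, Rmax, Rabs.
    repeat destruct Rle_dec; repeat destruct Rcase_abs; lra. }
  rewrite Rabs_mult, <- pow2_abs.
  pose proof (cos_remainder c) as H. rewrite <- (pow2_abs c) in H.
  pose proof (Rabs_pos c). pose proof (Rabs_pos x).
  assert (Rabs (cos c - 1) <= Rabs x)%R by nra. nra.
Qed.

(** * The complex exponential and its derivative *)

Lemma Cmod_le_Rabs (x y : R) : (Cmod (x, y) <= Rabs x + Rabs y)%R.
Proof.
replace (x, y) with (RtoC x + RtoC y * Ci) by (apply injective_projections; simpl; ring).
eapply Rle_trans; [apply Cmod_triangle|].
rewrite Cmod_mult, Cmod_Ci, !Cmod_R. lra.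
Qed.

Lemma Cexp_add (z w : C) : Cexp (z + w) = Cexp z * Cexp w.
Proof.
destruct z as [x y], w as [x' y']. unfold Cexp, Cmult; simpl.
rewrite exp_plus, cos_plus, sin_plus. f_equal; ring.
Qed.

Lemma Cexp_RtoC (x : R) : Cexp x = exp x.
Proof. unfold Cexp, RtoC; simpl. rewrite cos_0, sin_0. f_equal; ring. Qed.

(** The two coordinates of the remainder split into four terms, each at most 2 r^2 with r = |h|; the
    constant 9 leaves slack over their sum. *)
Lemma Cexp_remainder (h : C) :
  (Cmod h <= / 2 -> Cmod (Cexp h - 1 - h) <= 9 * Cmod h ^ 2)%R.
Proof.
intros Hh. destruct h as [x y].
pose proof (Rmax_Cmod (x, y)) as Hm. simpl in Hm.
pose proof (Rmax_l (Rabs x) (Rabs y)). pose proof (Rmax_r (Rabs x) (Rabs y)).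
set (r := Cmod (x, y)) in *.
assert (Hx : (Rabs x <= r)%R) by lra. assert (Hy : (Rabs y <= r)%R) by lra.
clearbody r.
pose proof (Rabs_pos x). pose proof (Rabs_pos y).
replace (Cexp (x, y) - 1 - (x, y)) with
  ((exp x - 1 - x) + exp x * (cos y - 1), exp x * (sin y - y) + (exp x - 1) * y)%R
  by (apply injective_projections; simpl; ring).
eapply Rle_trans; [apply Cmod_le_Rabs|].
assert (Hx2 : (x <= / 2)%R) by (pose proof (Rle_abs x); lra).
pose proof (exp_remainder x Hx2) as E1. rewrite <- pow2_abs in E1.
pose proof (cos_remainder y) as E2. rewrite <- pow2_abs in E2.
assert (E3 : (Rabs (sin y - y) <= Rabs y ^ 2)%R)
  by (rewrite pow2_abs; apply sin_remainder; lra).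
assert (E4 : (Rabs (exp x - 1) <= 2 * Rabs x)%R).
{ replace (exp x - 1)%R with ((exp x - 1 - x) + x)%R by ring.
  eapply Rle_trans; [apply Rabs_triang|]. nra. }
assert (E5 : (0 <= exp x <= 2)%R).
{ split; [left; apply exp_pos|]. pose proof (Rle_abs (exp x - 1)). lra. }
assert (Hxr : (Rabs x ^ 2 <= r ^ 2)%R) by nra.
assert (Hyr : (Rabs y ^ 2 <= r ^ 2)%R) by nra.
assert (Hxyr : (Rabs x * Rabs y <= r ^ 2)%R) by nra.
eapply Rle_trans; [apply Rplus_le_compat; apply Rabs_triang|].
rewrite !Rabs_mult, (Rabs_right (exp x)) by lra.
pose proof (Rabs_pos (cos y - 1)). pose proof (Rabs_pos (sin y - y)).
assert (exp x * Rabs (cos y - 1) <= 2 * r ^ 2)%R by nra.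
assert (exp x * Rabs (sin y - y) <= 2 * r ^ 2)%R by nra.
assert (Rabs (exp x - 1) * Rabs y <= 2 * r ^ 2)%R by nra.
lra.
Qed.

(* Coquelicot puts two normed module structures on [C], with different
   uniform structures; its results on products and compositions are about
   [AbsRing_NormedModule], while [C_derive] is about [C_NormedModule]. *)
Lemma is_derive_C_NormedModule (f : C -> C) (z l : C) :
  is_derive (K := C_AbsRing) (V := AbsRing_NormedModule C_AbsRing) f z l ->
  is_derive (K := C_AbsRing) (V := C_NormedModule) f z l.
Proof. intros [_ H]. split; [apply is_linear_scal_l | exact H]. Qed.

(** By the addition formula, the linearization error at z is [Cexp z] times the remainder at 0,
    which is quadratic in the increment. *)
Lemma is_derive_Cexp (z : C) :
  is_derive (K := C_AbsRing) (V := AbsRing_NormedModule C_AbsRing) Cexp z (Cexp z).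
Proof.
split; [apply is_linear_scal_l|].
intros x Hx. apply (is_filter_lim_locally_unique (K := C_AbsRing) (V := AbsRing_NormedModule C_AbsRing)) in Hx. rewrite <- Hx. clear x Hx.
intros eps.
(* The quadratic error is at most M |h|^2, and the added 1 makes M visibly positive. Below, radius
   1/2 admits [Cexp_remainder] and radius eps / M gives M |h| <= eps. *)
set (M := (9 * Cmod (Cexp z) + 1)%R).
assert (HM : (0 < M)%R) by (unfold M; pose proof (Cmod_ge_0 (Cexp z)); lra).
assert (Hd : (0 < Rmin (/ 2) (eps / M))%R)
  by (apply Rmin_pos; [lra | apply Rdiv_lt_0_compat; [apply cond_pos | easy]]).
exists (mkposreal _ Hd). intros y Hy.
change (Cmod (y - z) < Rmin (/ 2) (eps / M))%R in Hy.
change (Cmod (Cexp y - Cexp z - (y - z) * Cexp z) <= eps * Cmod (y - z))%R.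
set (h := y - z) in *.
replace (Cexp y - Cexp z - h * Cexp z) with (Cexp z * (Cexp h - 1 - h)).
- assert (H1 := Rmin_l (/ 2) (eps / M)). assert (H2 := Rmin_r (/ 2) (eps / M)).
  rewrite Cmod_mult.
  pose proof (Cexp_remainder h ltac:(lra)) as E.
  pose proof (Cmod_ge_0 h). pose proof (Cmod_ge_0 (Cexp z)).
  assert (H3 : (M * Cmod h <= eps)%R).
  { apply Rle_trans with (M * (eps / M))%R; [apply Rmult_le_compat_l; lra|].
    right; field; lra. }
  apply Rle_trans with (Cmod (Cexp z) * (9 * Cmod h ^ 2))%R; [now apply Rmult_le_compat_l|].
  unfold M in H3. nra.
- replace y with (z + h) by (unfold h; ring). rewrite Cexp_add. ring.
Qed.

(** * Derivatives of the quasipolynomial *)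

(** A family that contains the quasipolynomial and is closed under differentiation, so that
    differentiating only updates four coefficients. *)
Definition affine_exp (tau : R) (al be p q s : C) : C :=
  al * s + be - Cexp (- s * tau) * (s * p + q).

Lemma is_derive_affine (p q s : C) :
  is_derive (K := C_AbsRing) (V := AbsRing_NormedModule C_AbsRing) (fun x : C => x * p + q) s p.
Proof.
assert (H := is_derive_plus (K := C_AbsRing) (V := AbsRing_NormedModule C_AbsRing)
  (fun x => scal x p) (fun _ => q) s p zero).
rewrite plus_zero_r in H.
apply H.
- apply filterdiff_linear, is_linear_scal_l.
- apply @is_derive_const.
Qed.

Lemma is_derive_affine_exp (tau : R) (al be p q s : C) :
  is_derive (K := C_AbsRing) (V := C_NormedModule) (affine_exp tau al be p q) s
    (affine_exp tau 0 al (- tau * p) (p - tau * q) s).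
Proof.
(* The exponent carries a summand 0 to match the shape of [is_derive_affine]. *)
assert (HE : is_derive (K := C_AbsRing) (V := AbsRing_NormedModule C_AbsRing)
          (fun x : C => Cexp (x * (- tau) + 0)) s (- tau * Cexp (s * (- tau) + 0))).
{ apply (is_derive_comp (K := C_AbsRing) (V := AbsRing_NormedModule C_AbsRing) Cexp
           (fun x : C => x * (- tau) + 0)).
  - apply is_derive_Cexp.
  - apply is_derive_affine. }
assert (HP := is_derive_mult (K := C_AbsRing) _ _ _ _ _ HE (is_derive_affine p q s) Cmult_comm).
assert (HF := is_derive_minus (K := C_AbsRing) (V := AbsRing_NormedModule C_AbsRing)
          _ _ _ _ _ (is_derive_affine al be s) HP).
apply is_derive_C_NormedModule.
match type of HF with is_derive _ _ ?l =>
  replace (affine_exp tau 0 al (- tau * p) (p - tau * q) s) with (l : C) end.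
- revert HF. apply is_derive_ext. intros t.
  change (t * al + be - Cexp (t * - tau + 0) * (t * p + q) = affine_exp tau al be p q t).
  unfold affine_exp. replace (t * - tau + 0) with (- t * tau) by ring. ring.
- change (al - (- tau * Cexp (s * - tau + 0) * (s * p + q) + Cexp (s * - tau + 0) * p)
     = affine_exp tau 0 al (- tau * p) (p - tau * q) s).
  unfold affine_exp. replace (s * - tau + 0) with (- s * tau) by ring. ring.
Qed.

Lemma C_derive_affine_exp (tau : R) (al be p q : C) :
  C_derive (affine_exp tau al be p q) = affine_exp tau 0 al (- tau * p) (p - tau * q).
Proof.
apply functional_extensionality. intros s.
apply is_C_derive_unique, is_derive_affine_exp.
Qed.

Lemma C_derive_n_affine_exp (tau : R) (al be p q : C) (k : nat) :
  exists al' be' p' q' : C,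
    C_derive_n (affine_exp tau al be p q) k = affine_exp tau al' be' p' q'.
Proof.
induction k as [|k (al' & be' & p' & q' & IH)].
- now exists al, be, p, q.
- simpl. rewrite IH, C_derive_affine_exp. eauto.
Qed.

Lemma quasipolynomial_affine_exp (a b c d tau : R) :
  quasipolynomial a b c d tau = affine_exp tau 1 (- a) d (b * c - a * d).
Proof.
apply functional_extensionality. intros s.
unfold quasipolynomial, affine_exp. ring.
Qed.

Lemma affine_exp_RtoC (tau al be p q s : R) :
  affine_exp tau al be p q s = RtoC (al * s + be - exp (- (s * tau)) * (s * p + q))%R.
Proof.
unfold affine_exp.
replace (- RtoC s * RtoC tau) with (RtoC (- (s * tau))%R)
  by (rewrite RtoC_opp, RtoC_mult; ring).
now rewrite Cexp_RtoC, RtoC_minus, !RtoC_plus, !RtoC_mult, RtoC_plus, RtoC_mult.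
Qed.

(** At a real point all coefficients are real, so the vanishing conditions become real equations in
    [E], [d] and the value [P] of the affine factor. *)
Lemma C_derive_n_quasipolynomial (a b c d tau s0 : R) :
  let E := exp (- (s0 * tau)) in
  let P := (d * (s0 - a) + b * c)%R in
  let Q := quasipolynomial a b c d tau in
  C_derive_n Q 0 s0 = RtoC (s0 - a - E * P)%R /\
  C_derive_n Q 1 s0 = RtoC (1 - E * (d - tau * P))%R /\
  C_derive_n Q 2 s0 = RtoC (E * tau * (2 * d - tau * P))%R /\
  C_derive_n Q 3 s0 = RtoC (- (E * tau ^ 2 * (3 * d - tau * P)))%R.
Proof.
intros E P Q. unfold Q. rewrite quasipolynomial_affine_exp. simpl C_derive_n.
rewrite !C_derive_affine_exp.
replace (RtoC b * c - RtoC a * d) with (RtoC (b * c - a * d)%R)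
  by now rewrite RtoC_minus, !RtoC_mult.
rewrite <- !RtoC_opp.
repeat rewrite <- ?RtoC_mult, <- ?RtoC_minus.
rewrite !affine_exp_RtoC. fold E. unfold P.
repeat split; f_equal; ring.
Qed.

(** * Triple roots and the coefficient relations *)

(** The equations are solved from the top order down: the second derivative gives tau P = 2 d, the
    first then gives d, the value gives a, and the definition of [P] gives b c. Conversely, the
    relations make the third derivative equal to tau^2. *)
Lemma multiplicity_three_iff (a b c d tau s0 : R) : (0 < tau)%R ->
  root_of_multiplicity (quasipolynomial a b c d tau) s0 3 <->
  triple_root_relations a b c d tau s0.
Proof.
intros Ht.
destruct (C_derive_n_quasipolynomial a b c d tau s0) as (D0 & D1 & D2 & D3).
set (E := exp (- (s0 * tau))) in *.
set (F := exp (s0 * tau)).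
set (P := (d * (s0 - a) + b * c)%R) in *.
assert (HF : (0 < F)%R) by apply exp_pos.
assert (HE : E = (/ F)%R) by apply exp_Ropp.
split.
- intros (_ & Hz & _).
  pose proof (Hz 0%nat ltac:(lia)) as H0. pose proof (Hz 1%nat ltac:(lia)) as H1.
  pose proof (Hz 2%nat ltac:(lia)) as H2.
  rewrite D0 in H0. rewrite D1 in H1. rewrite D2 in H2.
  apply RtoC_inj in H0. apply RtoC_inj in H1. apply RtoC_inj in H2.
  rewrite HE in *.
  assert (Hi : (/ F <> 0)%R) by (apply Rinv_neq_0_compat; lra).
  assert (HP : (P = 2 * d / tau)%R).
  { assert (G : (2 * d - tau * P = 0)%R).
    { apply Rmult_integral in H2 as [H2|H2]; [|easy].
      apply Rmult_integral in H2 as [H2|H2]; lra. }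
    apply Rmult_eq_reg_l with tau; [|lra]. field_simplify; lra. }
  assert (Hd : (d = - F)%R).
  { rewrite HP in H1. replace (d - tau * (2 * d / tau))%R with (- d)%R in H1 by (field; lra).
    apply Rmult_eq_reg_l with (/ F)%R; [|easy].
    replace (/ F * - F)%R with (-1)%R by (field; lra). lra. }
  assert (Ha : (a = s0 + 2 / tau)%R).
  { rewrite HP, Hd in H0.
    replace (/ F * (2 * - F / tau))%R with (- (2 / tau))%R in H0 by (field; lra). lra. }
  repeat split; try easy.
  replace (b * c)%R with (P - d * (s0 - a))%R by (unfold P; ring).
  rewrite HP, Hd, Ha. fold F. field. lra.
- intros (Ha & Hd & Hbc). fold F in Hd, Hbc.
  assert (HP : (P = - (2 / tau) * F)%R) by (unfold P; rewrite Hbc, Hd, Ha; field; lra).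
  repeat split.
  + intros k _. rewrite quasipolynomial_affine_exp.
    destruct (C_derive_n_affine_exp tau 1 (- a) d (b * c - a * d) k) as (al & be & p & q & ->).
    apply filter_forall. intros z. eexists. apply is_derive_affine_exp.
  + intros k Hk. destruct k as [|[|[|k]]]; [| | |lia].
    * rewrite D0. f_equal. rewrite HE, HP, Ha. field. lra.
    * rewrite D1. f_equal. rewrite HE, HP, Hd. field. lra.
    * rewrite D2. f_equal. rewrite HE, HP, Hd. field. lra.
  + rewrite D3. intros H. apply RtoC_inj in H.
    rewrite HE, HP, Hd in H.
    replace (- (/ F * tau ^ 2 * (3 * - F - tau * (- (2 / tau) * F))))%R
      with (tau ^ 2)%R in H by (field; lra).
    nra.
Qed.

(** * Real inequalities for the hyperbolic functions *)

Lemma positive_of_derive_positive (f f' : R -> R) (x : R) :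
  f 0%R = 0%R -> (forall y, is_derive f y (f' y)) ->
  (forall y, 0 < y -> 0 < f' y)%R -> (0 < x -> 0 < f x)%R.
Proof.
intros H0 Hd Hp Hx.
destruct (MVT_cor2 f f' 0 x Hx) as (c & E & Hc).
- intros y _. apply is_derive_Reals, Hd.
- assert (0 < f' c)%R by (apply Hp; lra). nra.
Qed.

Lemma exp_sub_exp_opp_gt (x : R) : (0 < x -> 2 * x < exp x - exp (- x))%R.
Proof.
intros Hx.
assert (0 < exp x - exp (- x) - 2 * x)%R; [|lra].
apply (positive_of_derive_positive (fun x => exp x - exp (- x) - 2 * x)%R
         (fun x => exp x + exp (- x) - 2)%R); [| | |easy].
- rewrite Ropp_0, exp_0. ring.
- intros y. auto_derive; [easy | ring].
- intros y Hy. pose proof (exp_ineq1 y ltac:(lra)). pose proof (exp_ineq1 (- y) ltac:(lra)). lra.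
Qed.

(** This is tanh (x / 2) < x / 2 cleared of denominators; the derivative is positive because exp y >
    1 + y. *)
Lemma exp_opp_mul_gt (x : R) : (0 < x -> 0 < x - 2 + exp (- x) * (x + 2))%R.
Proof.
apply (positive_of_derive_positive (fun x => x - 2 + exp (- x) * (x + 2))%R
         (fun x => 1 - exp (- x) * (x + 1))%R).
- rewrite Ropp_0, exp_0. ring.
- intros y. auto_derive; [easy | ring].
- intros y Hy. pose proof (exp_ineq1 y ltac:(lra)). pose proof (exp_pos (- y)).
  assert (exp y * exp (- y) = 1)%R by (rewrite <- exp_plus, Rplus_opp_r; apply exp_0).
  nra.
Qed.

Lemma exp_opp_mul_eq_0 (x : R) : (x - 2 + exp (- x) * (x + 2) = 0 -> x = 0)%R.
Proof.
intros H. destruct (Rtotal_order x 0) as [Hx|[Hx|Hx]]; [|easy|].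
(* Replacing x by - x multiplies the expression by - exp x, so a negative zero would yield a
   positive one. *)
- pose proof (exp_opp_mul_gt (- x) ltac:(lra)) as G. rewrite Ropp_involutive in G.
  assert (exp x * exp (- x) = 1)%R by (rewrite <- exp_plus, Rplus_opp_r; apply exp_0).
  pose proof (exp_pos x). nra.
- pose proof (exp_opp_mul_gt x Hx). lra.
Qed.

Lemma eq_0_of_exp_sub_sin (p q : R) :
  (q <> 0 -> q * (exp p - exp (- p)) = 2 * p * sin q -> p = 0)%R.
Proof.
intros Hq H.
assert (G : forall r, (0 < r -> q * (exp r - exp (- r)) <> 2 * r * sin q)%R).
{ intros r Hr E. pose proof (exp_sub_exp_opp_gt r Hr) as L.
  pose proof (Rabs_sin_le q) as S. pose proof (Rabs_pos_lt q Hq).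
  apply (f_equal Rabs) in E. rewrite !Rabs_mult in E.
  rewrite (Rabs_right (exp r - exp (- r))), (Rabs_right 2), (Rabs_right r) in E by lra.
  nra. }
destruct (Rtotal_order p 0) as [Hp|[Hp|Hp]]; [|easy|].
(* Both sides of the equation are odd in p. *)
- destruct (G (- p)%R); [lra|]. rewrite Ropp_involutive. lra.
- now destruct (G p).
Qed.

(** * Roots of the normalized quasipolynomial *)

Definition normalized_quasipolynomial (u : C) : C := u - 2 + Cexp (- u) * (u + 2).

Lemma normalized_root_components (p q : R) :
  normalized_quasipolynomial (p, q) = 0 <->
  (p - 2 + exp (- p) * ((p + 2) * cos q + q * sin q) = 0 /\
   q + exp (- p) * (q * cos q - (p + 2) * sin q) = 0)%R.
Proof.
unfold normalized_quasipolynomial, Cexp.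
assert (E : forall x y : R, (x, y) = RtoC 0 <-> x = 0%R /\ y = 0%R).
{ intros x y. split; [now intros [= -> ->] | now intros [-> ->]]. }
simpl. unfold Cmult, Cplus, Cminus, Copp; simpl. rewrite E, cos_neg, sin_neg.
lra.
Qed.

Lemma normalized_root_imaginary (p q : R) :
  normalized_quasipolynomial (p, q) = 0 -> p = 0%R.
Proof.
intros H. apply normalized_root_components in H as [HR HI].
destruct (Req_dec q 0) as [->|Hq].
{ apply exp_opp_mul_eq_0. rewrite cos_0, sin_0 in HR. lra. }
apply (eq_0_of_exp_sub_sin p q Hq).
pose proof (exp_pos p).
assert (Hee : (exp p * exp (- p) = 1)%R) by (rewrite <- exp_plus, Rplus_opp_r; apply exp_0).
pose proof (sin2_cos2 q) as Hcs. unfold Rsqr in Hcs.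
set (e := exp (- p)) in *. set (c := cos q) in *. set (s := sin q) in *.
set (M := ((p + 2) ^ 2 + q ^ 2)%R).
assert (HM : (0 < M)%R)
  by (unfold M; pose proof (pow2_ge_0 (p + 2)); pose proof (pow2_gt_0 q Hq); lra).
(* Multiplying by the conjugate of [u + 2] separates [cos q] and [sin q]. *)
assert (Hc : (e * c * M = 4 - p ^ 2 - q ^ 2)%R).
{ transitivity ((p + 2) * (p - 2 + e * ((p + 2) * c + q * s)) + q * (q + e * (q * c - (p + 2) * s))
      + (4 - p ^ 2 - q ^ 2))%R; [unfold M; ring | rewrite HR, HI; ring]. }
assert (Hs : (e * s * M = 4 * q)%R).
{ transitivity (q * (p - 2 + e * ((p + 2) * c + q * s)) - (p + 2) * (q + e * (q * c - (p + 2) * s))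
      + 4 * q)%R; [unfold M; ring | rewrite HR, HI; ring]. }
(* Squaring and adding eliminates q from the trigonometric terms: this is |exp (- u)|^2 |u + 2|^2 =
   |u - 2|^2. *)
assert (He : (e ^ 2 * M = (p - 2) ^ 2 + q ^ 2)%R).
{ apply Rmult_eq_reg_r with M; [|lra].
  transitivity ((e * c * M) ^ 2 + (e * s * M) ^ 2)%R.
  - transitivity (e ^ 2 * M ^ 2 * (s * s + c * c))%R; [rewrite Hcs|]; ring.
  - rewrite Hc, Hs. unfold M. ring. }
(* After multiplication by e M, the left side is q (M - e^2 M) = 8 p q, and the right side is 2 p
   times e s M = 4 q. *)
apply Rmult_eq_reg_r with (e * M)%R; [|assert (0 < e)%R by apply exp_pos; nra].
transitivity (q * (exp p * e) * M - q * (e ^ 2 * M))%R; [ring|].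
transitivity (2 * p * (e * s * M))%R; [|ring].
rewrite Hee, He, Hs. unfold M. ring.
Qed.

(** At u = 2 i y the double-angle formulas make the two coordinates 4 g sin y and 4 g cos y with g =
    y cos y - sin y. Sine and cosine have no common zero, so the roots are the zeros of g. *)
Lemma normalized_root_iff (u : C) :
  normalized_quasipolynomial u = 0 <-> exists xi : R, Xi xi /\ u = (0, 2 * xi)%R.
Proof.
assert (Hy : forall y : R, normalized_quasipolynomial (0, 2 * y)%R = 0 <->
          (sin y * (y * cos y - sin y) = 0 /\ cos y * (y * cos y - sin y) = 0)%R).
{ intros y. rewrite normalized_root_components, Ropp_0, exp_0, sin_2a, cos_2a.
  pose proof (sin2_cos2 y) as H. unfold Rsqr in H.
  assert (E1 : (0 - 2 + 1 * ((0 + 2) * (cos y * cos y - sin y * sin y) + 2 * y * (2 * sin y * cos y))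
     = 4 * (sin y * (y * cos y - sin y)))%R).
  (* Writing 1 as sin^2 + cos^2 turns the claim into a polynomial identity. *)
  { replace (0 - 2)%R with (- 2 * (sin y * sin y + cos y * cos y))%R by (rewrite H; ring). ring. }
  assert (E2 : (2 * y + 1 * (2 * y * (cos y * cos y - sin y * sin y) - (0 + 2) * (2 * sin y * cos y))
     = 4 * (cos y * (y * cos y - sin y)))%R).
  { replace (2 * y)%R with (2 * y * (sin y * sin y + cos y * cos y))%R at 1 by (rewrite H; ring). ring. }
  rewrite E1, E2. lra. }
split.
- destruct u as [p q]. intros H.
  pose proof (normalized_root_imaginary p q H) as ->.
  exists (q / 2)%R.
  assert (Eq : q = (2 * (q / 2))%R) by field.
  rewrite <- Eq. split; [|easy].
  rewrite Eq in H. apply Hy in H as [H1 H2]. set (y := (q / 2)%R) in *.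
  pose proof (sin2_cos2 y) as H3. unfold Rsqr in H3.
  assert (H4 : (y * cos y = sin y)%R).
  { apply Rminus_diag_uniq. rewrite <- (Rmult_1_l (_ - _)), <- H3.
    transitivity (sin y * (sin y * (y * cos y - sin y)) + cos y * (cos y * (y * cos y - sin y)))%R;
      [ring | rewrite H1, H2; ring]. }
  (* A zero of the cosine would also be one of the sine, as sin y = y cos y. *)
  assert (Hc : cos y <> 0%R) by (intros Z; rewrite <- H4, Z in H3; lra).
  split; [easy|]. unfold tan. rewrite <- H4. field. easy.
- intros (y & (Hc & Ht) & ->). apply Hy.
  assert (H4 : (y * cos y = sin y)%R) by (rewrite <- Ht at 1; unfold tan; field; easy).
  rewrite H4. split; ring.
Qed.

(** * Transfer back to the original variable *)

Lemma quasipolynomial_normalized (a b c d tau s0 : R) (s : C) : (0 < tau)%R ->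
  triple_root_relations a b c d tau s0 ->
  tau * quasipolynomial a b c d tau s = normalized_quasipolynomial ((s - s0) * tau).
Proof.
intros Ht (Ha & Hd & Hbc).
assert (Ht' : RtoC tau <> 0) by (intros H; apply RtoC_inj in H; lra).
unfold quasipolynomial, normalized_quasipolynomial.
(* Splitting off exp (- s0 tau) lets it cancel the factor exp (s0 tau) common to d and b c. *)
replace (- s * tau) with (- ((s - s0) * tau) + RtoC (- (s0 * tau))%R)
  by (rewrite RtoC_opp, RtoC_mult; ring).
rewrite Cexp_add, Cexp_RtoC.
rewrite <- !RtoC_mult, Hbc, Hd, Ha.
set (X := Cexp _).
assert (HF : RtoC (exp (- (s0 * tau))) * RtoC (exp (s0 * tau)) = 1)
  by now rewrite <- RtoC_mult, <- exp_plus, Rplus_opp_l, exp_0.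
rewrite !RtoC_mult, !RtoC_opp, !RtoC_plus, !RtoC_div by lra.
set (F := RtoC (exp (s0 * tau))) in *. set (E := RtoC (exp (- (s0 * tau)))) in *.
transitivity ((s - s0) * tau - 2 + X * (E * F) * ((s - s0) * tau + 2));
  [field; easy | rewrite HF; ring].
Qed.

Lemma quasipolynomial_root_iff (a b c d tau s0 : R) (s : C) : (0 < tau)%R ->
  triple_root_relations a b c d tau s0 ->
  quasipolynomial a b c d tau s = 0 <->
  exists xi : R, Xi xi /\ s = s0 + Ci * (2 / tau) * xi.
Proof.
intros Ht Hrel.
assert (Ht' : RtoC tau <> 0) by (intros H; apply RtoC_inj in H; lra).
pose proof (quasipolynomial_normalized a b c d tau s0 s Ht Hrel) as E.
assert (Hxi : forall y : R, (0, 2 * y)%R = Ci * 2 * y)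
  by (intros y; apply injective_projections; simpl; ring).
transitivity (normalized_quasipolynomial ((s - s0) * tau) = 0).
{ rewrite <- E. split; intros H; [rewrite H; ring|].
  replace (quasipolynomial a b c d tau s)
    with (/ tau * (tau * quasipolynomial a b c d tau s)) by (field; easy).
  rewrite H. ring. }
rewrite normalized_root_iff.
split; intros (xi & Hx & H); exists xi; (split; [easy|]); rewrite Hxi in *.
- transitivity (s0 + (s - s0) * tau / tau); [field; easy | rewrite H; field; easy].
- rewrite H. field. easy.
Qed.

Theorem theorem4 (a b c d tau s0 : R) (tau_pos : (0 < tau)%R) :
  (root_of_multiplicity (quasipolynomial a b c d tau) s0 3 <->
     triple_root_relations a b c d tau s0)
  /\
  (triple_root_relations a b c d tau s0 ->
     dominant_root (quasipolynomial a b c d tau) s0 /\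
     (forall s : C, s <> s0 -> quasipolynomial a b c d tau s = 0 -> Re s = s0))
  /\
  (triple_root_relations a b c d tau s0 ->
     forall s : C,
       quasipolynomial a b c d tau s = 0 <->
       exists xi : R, Xi xi /\ s = s0 + Ci * (2 / tau) * xi).
Proof.
split; [now apply multiplicity_three_iff|].
split; [|now intros Hrel s; apply quasipolynomial_root_iff].
intros Hrel.
assert (HRe : forall s : C, quasipolynomial a b c d tau s = 0 -> Re s = s0).
{ intros s H. apply (quasipolynomial_root_iff a b c d tau s0 s tau_pos Hrel) in H.
  destruct H as (xi & _ & ->).
  replace (Ci * (2 / tau) * xi) with (Ci * RtoC (2 / tau * xi)%R)
    by (rewrite RtoC_mult, RtoC_div by lra; ring).
  simpl. ring. }
split; [split|].
- apply (quasipolynomial_root_iff a b c d tau s0 s0 tau_pos Hrel).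
  (* The root [s0] itself corresponds to the fixed point 0 of the tangent. *)
  exists 0%R. split; [|ring].
  split; [rewrite cos_0; lra | apply tan_0].
- intros s _ H. rewrite (HRe s H). simpl. lra.
- intros s _. apply HRe.
Qed.
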